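(* For every integer $n \geq 1$, $f_2(n) \leq x_n$, where $(x_n)_{n\ge1}$ is the sequence defined by $x_1 = 0, x_2 = 1, x_3 = 2, x_4 = 4, x_5 = 5$ and, for $n \geq 6$, $$x_n = (n - 1) + \begin{cases} x_{\frac{n + 1}{2}} + x_{\frac{n - 3}{2}}, & n \equiv 1 \pmod 4,\\ 2 x_{\frac{n - 1}{2}}, & n \equiv 3 \pmod 4,\\ x_{\frac{n}{2}} + x_{\frac{n - 2}{2}}, & n \text{ even}. \end{cases}$$
   Context: An oriented graph is a finite directed graph with no loops, no multiple arcs and no directed cycle of length $2$. The weak diameter of an oriented graph $\overrightarrow{G}$ is the minimum $d$ such that for any two distinct vertices $u,v$ there is a directed path of length at most $d$ from $u$ to $v$ or from $v$ to $u$. For $n\ge1$, $f_2(n)$ denotes the minimum number of arcs of an oriented graph on $n$ vertices having weak diameter at most $2$. *)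

(* Defs.v *)
From mathcomp Require Import all_boot zify.

Set Implicit Arguments.
Unset Strict Implicit.
Unset Printing Implicit Defensive.

Section OrientedGraphs.

Variable T : finType.
Implicit Types (A : {set T * T}) (u v : T) (d k : nat).

(* A digraph on T is its set of arcs, which rules out multiple arcs; (u, v)   *)
(* is the arc from u to v.                                                    *)
Definition arc A : rel T := fun u v => (u, v) \in A.

Definition oriented A : bool :=
  [forall u, ~~ arc A u u] && [forall u, forall v, ~~ (arc A u v && arc A v u)].

(* The path is u :: p, so that the size of p is its number of arcs.           *)
Definition dipath_le A d u v : bool :=
  [exists k : 'I_d.+1, exists p : k.-tuple T,
     [&& path (arc A) u p, uniq (u :: p) & last u p == v]].

Definition weakly_within A d : bool :=
  [forall u, forall v, (u != v) ==> dipath_le A d u v || dipath_le A d v u].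

(* "d is the weak diameter of A"; no d satisfies this if the weak diameter is *)
(* infinite.                                                                  *)
Definition is_weak_diameter A d : bool :=
  weakly_within A d && [forall d' : 'I_d, ~~ weakly_within A d'].

Definition weak_diameter_le A k : bool :=
  [exists d : 'I_k.+1, is_weak_diameter A d].

Lemma weakly_within_diameter_le A k : weakly_within A k -> weak_diameter_le A k.
Proof.
move=> wk; have ex : exists d, weakly_within A d by exists k.
case: (ex_minnP ex) => d wd min_d.
have lt_dk : d < k.+1 by rewrite ltnS min_d.
apply/existsP; exists (Ordinal lt_dk); rewrite /is_weak_diameter wd /=.
apply/forallP=> d'; apply/negP=> /min_d; by rewrite leqNgt ltn_ord.
Qed.

End OrientedGraphs.

(* Oriented graphs on n vertices are taken, up to isomorphism, on 'I_n.       *)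
Definition f2_size (n : nat) : pred nat := fun m =>
  [exists A : {set 'I_n * 'I_n},
     [&& oriented A, weak_diameter_le A 2 & #|A| == m]].

Lemma f2_size_exists n : exists m, f2_size n m.
Proof.
pose A := [set a : 'I_n * 'I_n | a.1 < a.2].
exists #|A|; apply/existsP; exists A; rewrite eqxx andbT; apply/andP; split.
  apply/andP; split; apply/forallP=> u; first by rewrite /arc inE ltnn.
  by apply/forallP=> v; rewrite /arc !inE /=; case: ltngtP.
apply: weakly_within_diameter_le.
have one (u v : 'I_n) : u < v -> dipath_le A 2 u v.
  move=> lt_uv; apply/existsP; exists (Ordinal (isT : 1 < 3)).
  apply/existsP; exists [tuple v]; rewrite /= /arc !inE /= lt_uv eqxx.
  by rewrite -val_eqE /= ltn_eqF.
apply/forallP=> u; apply/forallP=> v; apply/implyP; rewrite -val_eqE /=.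
by rewrite neq_ltn => /orP[] /one ->; rewrite ?orbT.
Qed.

Definition f2 (n : nat) : nat := ex_minn (f2_size_exists n).

(* The right-hand side of the recurrence, with y in place of the sequence;    *)
(* the value at 0, outside the range of the sequence, is a dummy.             *)
Definition x_step (y : nat -> nat) (n : nat) : nat :=
  match n with
  | 0 => 0
  | 1 => 0
  | 2 => 1
  | 3 => 2
  | 4 => 4
  | 5 => 5
  | _ => (n - 1) +
      (if n %% 4 == 1 then y ((n + 1) %/ 2) + y ((n - 3) %/ 2)
       else if n %% 4 == 3 then 2 * y ((n - 1) %/ 2)
       else y (n %/ 2) + y ((n - 2) %/ 2))
  end.

(* All recursive calls are at smaller indices, so n.+1 iterations reach the   *)
(* value at n; x_seqE below is the defining recurrence.                       *)
Definition x_seq (n : nat) : nat := iter n.+1 x_step (fun=> 0) n.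

Lemma x_step_ext (y z : nat -> nat) n :
  (forall m, m < n -> y m = z m) -> x_step y n = x_step z n.
Proof.
case: n => [|[|[|[|[|[|n]]]]]] // eq_yz; rewrite /x_step.
by rewrite !eq_yz //; lia.
Qed.

Lemma x_seqE n : x_seq n = x_step x_seq n.
Proof.
have stable k m : m < k -> iter k x_step (fun=> 0) m = x_seq m.
  elim/ltn_ind: m k => m IHm [//|k] le_mk; rewrite /x_seq !iterS.
  apply: x_step_ext => i lt_im; rewrite !IHm //.
  exact: leq_trans lt_im le_mk.
by rewrite {1}/x_seq iterS; apply: x_step_ext => m lt_mn; apply: stable.
Qed.

(* Main.v *)
From mathcomp Require Import all_boot zify.
Require Import Defs.

(** Take a vertex z and split the remaining n - 1 vertices into two parts of
    sizes a and b, on which optimal oriented graphs are placed; add all arcs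
    from the first part to z and from z to the second part. Vertices in
    different parts are then joined by a path of length 2 through z, so
    f2 (a + b + 1) <= a + b + f2 a + f2 b. The recurrence for x_n is this bound
    with a and b nearly equal; the value x_5 = 5 comes from the directed
    5-cycle instead, since the splitting bound gives only 6. *)

Set Implicit Arguments.
Unset Strict Implicit.
Unset Printing Implicit Defensive.

Definition reach2 (T : finType) (A : {set T * T}) (u v : T) : bool :=
  arc A u v || [exists w, arc A u w && arc A w v].

Definition weak2 (T : finType) (A : {set T * T}) : Prop :=
  forall u v, u != v -> reach2 A u v || reach2 A v u.

Lemma orientedP (T : finType) (A : {set T * T}) :
  reflect ((forall u, ~~ arc A u u) /\ forall u v, ~~ (arc A u v && arc A v u))
    (oriented A).
Proof.
apply: (iffP andP) => [[/forallP irr /forallP asym]|[irr asym]].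
  by split=> // u v; have /forallP := asym u.
by split; apply/forallP => // u; apply/forallP.
Qed.

(** The bound is a variable [d] because [weak_diameter_le A 2] only supplies some weak diameter
    [d <= 2]. The empty path is excluded by [u != v]. *)
Lemma dipath_le_reach2 (T : finType) (A : {set T * T}) d u v :
  d <= 2 -> u != v -> dipath_le A d u v -> reach2 A u v.
Proof.
move=> d2 neq_uv /existsP[[k ltkd]] /existsP[[p /= /eqP sz_p]].
move=> /and3P[pth _ /eqP last_v].
case: p sz_p pth last_v => [|w [|x [|y p]]] /= sz_p pth last_v.
- by rewrite last_v eqxx in neq_uv.
- by move: pth; rewrite last_v andbT /reach2 => ->.
- move: pth; rewrite last_v andbT /reach2 => uwv.
  by apply/orP; right; apply/existsP; exists w.
- by lia.
Qed.

(** [dipath_le] asks for distinct vertices along the path; the absence of loops keeps [w] apart from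
    both ends. *)
Lemma reach2_dipath_le (T : finType) (A : {set T * T}) u v :
  oriented A -> u != v -> reach2 A u v -> dipath_le A 2 u v.
Proof.
move=> /orientedP[irr _] neq_uv /orP[uv | /existsP[w /andP[uw wv]]].
  apply/existsP; exists (Ordinal (isT : 1 < 3)).
  by apply/existsP; exists [tuple v]; rewrite /= uv !inE neq_uv eqxx.
apply/existsP; exists (Ordinal (isT : 2 < 3)).
apply/existsP; exists [tuple w; v]; rewrite /= uw wv !inE eqxx.
have neq_uw : u != w by apply: contraTneq uw => ->.
have neq_wv : w != v by apply: contraTneq wv => ->.
by rewrite negb_or neq_uw neq_uv neq_wv.
Qed.

Lemma weak_diameter_le2P (T : finType) (A : {set T * T}) :
  oriented A -> reflect (weak2 A) (weak_diameter_le A 2).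
Proof.
move=> orA; apply: (iffP idP) => [/existsP[[d le_d2] /andP[/forallP wd _]] | wA].
  move=> u v neq_uv; have /forallP/(_ v)/implyP/(_ neq_uv) := wd u.
  by case/orP=> /dipath_le_reach2 -> //; rewrite ?orbT // eq_sym.
apply: weakly_within_diameter_le.
apply/forallP=> u; apply/forallP=> v; apply/implyP=> neq_uv.
by case/orP: (wA u v neq_uv) => /reach2_dipath_le -> //;
  rewrite ?orbT // eq_sym.
Qed.

(** Pulling [A] back along the enumeration of [T] gives an isomorphic graph on ['I_#|T|], so upper
    bounds on [f2] can be witnessed on any finite type, such as [option (S + T)]. *)
Lemma f2_le (T : finType) (A : {set T * T}) :
  oriented A -> weak2 A -> f2 #|T| <= #|A|.
Proof.
move=> orA wA; rewrite /f2; case: ex_minnP => m _; apply.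
pose f (p : 'I_#|T| * 'I_#|T|) : T * T := (enum_val p.1, enum_val p.2).
have bij_f : bijective f.
  exists (fun p => (enum_rank p.1, enum_rank p.2)) => -[x y];
    by rewrite /f /= ?enum_valK ?enum_rankK.
have arcE u v : arc (f @^-1: A) u v = arc A (enum_val u) (enum_val v).
  by rewrite /arc inE.
have orfA : oriented (f @^-1: A).
  by case/orientedP: orA => irr asym; apply/orientedP; split=> *; rewrite !arcE.
apply/existsP; exists (f @^-1: A); rewrite orfA /=; apply/andP; split.
  apply/(weak_diameter_le2P orfA) => u v neq_uv.
  have reach u' v' :
      reach2 A (enum_val u') (enum_val v') -> reach2 (f @^-1: A) u' v'.
    rewrite /reach2 arcE => /orP[-> // | /existsP[w uwv]].
    by apply/orP; right; apply/existsP; exists (enum_rank w);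
      rewrite !arcE enum_rankK.
  have neq : enum_val u != enum_val v by rewrite (inj_eq enum_val_inj).
  by case/orP: (wA _ _ neq) => /reach ->; rewrite ?orbT.
by rewrite on_card_preimset //; apply: onW_bij.
Qed.

Lemma f2_witness n :
  exists A : {set 'I_n * 'I_n}, [/\ oriented A, weak2 A & #|A| = f2 n].
Proof.
rewrite /f2; case: ex_minnP => m /existsP[A /and3P[orA wA /eqP <-]] _.
by exists A; split=> //; apply/weak_diameter_le2P.
Qed.

Section Join.

Variables (S T : finType) (A : {set S * S}) (B : {set T * T}).

(* [None] is the vertex joining the two parts. *)
Definition join_rel (x y : option (S + T)) : bool :=
  match x, y with
  | Some (inl u), Some (inl v) => arc A u v
  | Some (inr u), Some (inr v) => arc B u v
  | Some (inl _), None => true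
  | None, Some (inr _) => true
  | _, _ => false
  end.

Definition join : {set option (S + T) * option (S + T)} :=
  [set p | join_rel p.1 p.2].

Lemma arc_join x y : arc join x y = join_rel x y.
Proof. by rewrite /arc inE. Qed.

Lemma join_oriented : oriented A -> oriented B -> oriented join.
Proof.
move=> /orientedP[irrA asymA] /orientedP[irrB asymB].
apply/orientedP; split=> [[[u|u]|] | [[u|u]|] [[v|v]|]];
  rewrite !arc_join //=.
Qed.

(** Paths inside a part survive in [join]; every left vertex reaches [None] in one arc and every
    right vertex in two, through [None]. *)
Lemma join_weak2 : weak2 A -> weak2 B -> weak2 join.
Proof.
move=> wA wB.
have reachl u v : reach2 A u v -> reach2 join (Some (inl u)) (Some (inl v)).
  rewrite /reach2 arc_join /= => /orP[-> // | /existsP[w uwv]].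
  by apply/orP; right; apply/existsP; exists (Some (inl w)); rewrite !arc_join.
have reachr u v : reach2 B u v -> reach2 join (Some (inr u)) (Some (inr v)).
  rewrite /reach2 arc_join /= => /orP[-> // | /existsP[w uwv]].
  by apply/orP; right; apply/existsP; exists (Some (inr w)); rewrite !arc_join.
have reachlr u v : reach2 join (Some (inl u)) (Some (inr v)).
  by apply/orP; right; apply/existsP; exists None; rewrite !arc_join.
have reachl0 u : reach2 join (Some (inl u)) None by rewrite /reach2 arc_join.
have reach0r v : reach2 join None (Some (inr v)) by rewrite /reach2 arc_join.
move=> [[u|u]|] [[v|v]|] neq_uv;
  rewrite ?reachlr ?reachl0 ?reach0r ?orbT //.
(* Here [neq_uv] compares [Some (inl u)] with [Some (inl v)], which computes to [u != v]. *)
- by case/orP: (wA u v neq_uv) => /reachl ->; rewrite ?orbT.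
- by case/orP: (wB u v neq_uv) => /reachr ->; rewrite ?orbT.
Qed.

(** The arcs into [None], the arcs out of [None] and the arcs within each part are covered by images
    of [S], [T], [A] and [B], and an image is never larger than its source. *)
Lemma card_join : #|join| <= #|S| + #|T| + #|A| + #|B|.
Proof.
pose inlS u : option (S + T) := Some (inl u).
pose inrT v : option (S + T) := Some (inr v).
pose S0 := [set (inlS u, None : option (S + T)) | u : S].
pose T0 := [set (None : option (S + T), inrT v) | v : T].
pose A0 := [set (inlS p.1, inlS p.2) | p in A].
pose B0 := [set (inrT p.1, inrT p.2) | p in B].
have sub : join \subset S0 :|: T0 :|: A0 :|: B0.
  apply/subsetP=> -[[[u|u]|] [[v|v]|]]; rewrite !inE //= => uv.
  - suff -> : (Some (inl u), Some (inl v)) \in A0 by rewrite ?orbT.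
    by apply/imsetP; exists (u, v).
  - by rewrite (imset_f (fun u => (inlS u, None : option (S + T)))).
  - suff -> : (Some (inr u), Some (inr v)) \in B0 by rewrite ?orbT.
    by apply/imsetP; exists (u, v).
  - suff -> : (None, Some (inr v)) \in T0 by rewrite ?orbT.
    by apply/imsetP; exists v.
apply: leq_trans (subset_leq_card sub) _.
do 3![apply: leq_trans (leq_card_setU _ _) _;
      apply: leq_add; last exact: leq_imset_card].
exact: leq_imset_card.
Qed.

End Join.

Lemma f2_join a b : f2 (a + b).+1 <= a + b + (f2 a + f2 b).
Proof.
have [A [orA wA <-]] := f2_witness a; have [B [orB wB <-]] := f2_witness b.
have := f2_le (join_oriented orA orB) (join_weak2 wA wB).
rewrite card_option card_sum !card_ord => /leq_trans; apply.
by rewrite addnA; apply: leq_trans (card_join A B) _; rewrite !card_ord.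
Qed.

Lemma f2_subsingleton n : n <= 1 -> f2 n = 0.
Proof.
move=> n_le1; apply/eqP; rewrite -leqn0.
have orA : oriented (set0 : {set 'I_n * 'I_n}).
  by apply/orientedP; split=> *; rewrite /arc !inE.
have wA : weak2 (set0 : {set 'I_n * 'I_n}).
  move=> [u lt_u] [v lt_v]; rewrite -val_eqE /= => neq_uv; exfalso; lia.
by have := f2_le orA wA; rewrite card_ord cards0.
Qed.

Lemma f2_5 : f2 5 <= 5.
Proof.
pose C5 := [set (i, ordS i) | i : 'I_5].
have arcE u v : arc C5 u v = (v == ordS u).
  by apply/imsetP/eqP => [[i _ [-> ->]] | ->]; last exists u.
have reach1 u : reach2 C5 u (ordS u) by rewrite /reach2 arcE eqxx.
have reachS u : reach2 C5 u (ordS (ordS u)).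
  by apply/orP; right; apply/existsP; exists (ordS u); rewrite !arcE !eqxx.
suff: f2 #|'I_5| <= #|C5|.
  rewrite card_ord => /leq_trans; apply.
  by apply: leq_trans (leq_imset_card _ _) _; rewrite card_ord.
apply: f2_le => [|u v neq_uv].
  apply/orientedP; split=> [[[|[|[|[|[|?]]]]] ?] |
    [[|[|[|[|[|?]]]]] ?] [[|[|[|[|[|?]]]]] ?]]; by rewrite !arcE -!val_eqE.
(* [ordS] is the cyclic successor modulo 5: a nonzero difference is 1 or 2 up to sign, so one of the
   two vertices reaches the other in at most two steps. *)
have : [|| v == ordS u, v == ordS (ordS u), u == ordS v | u == ordS (ordS v)].
  case: u v neq_uv => [[|[|[|[|[|?]]]]] ?] [[|[|[|[|[|?]]]]] ?];
    by rewrite -!val_eqE.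
by case/or4P=> /eqP ->; rewrite ?reach1 ?reachS ?orbT.
Qed.

Theorem theorem6 (n : nat) (n_ge1 : 1 <= n) : f2 n <= x_seq n.
Proof.
elim/ltn_ind: n n_ge1 => n IHn n_ge1.
(* Both parts are nonempty because the induction hypothesis starts at index 1. *)
have split a b : 0 < a -> 0 < b -> n = (a + b).+1 ->
    f2 n <= n - 1 + (x_seq a + x_seq b).
  move=> a_gt0 b_gt0 n_eq; rewrite n_eq subn1 (leq_trans (f2_join a b)) //.
  by rewrite leq_add2l leq_add ?IHn //; lia.
rewrite x_seqE; case: n n_ge1 IHn split => [|[|[|[|[|[|n]]]]]] // _ _ split.
- by rewrite f2_subsingleton.
(* For two vertices one part is empty, so [f2_join] is applied directly instead of [split]. *)
- by have := f2_join 1 0; rewrite (@f2_subsingleton 0) ?(@f2_subsingleton 1).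
- exact: (split 1 1).
- exact: (split 2 1).
- exact: f2_5.
(* In each branch the two indices are positive and sum to one less than the number of vertices. They
   are both odd when that number is odd, and consecutive when it is even, which is the last
   branch. *)
- rewrite /x_step; case: ifP => [/eqP ?|?]; first by apply: split; lia.
  case: ifP => [/eqP ?|?]; last by apply: split; lia.
  by rewrite mul2n -addnn; apply: split; lia.
Qed.
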